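(* Let $\mathbf{g}:S\to\mathbb{R}^n$ be an infinitely differentiable mapping on an open set $S\subseteq\mathbb{R}^n$ such that for any point $\mathbf{x}^\ast\in S$ we have $\operatorname{rank} J_{\mathbf{g}}(\mathbf{x}^\ast)=k$. Then the topological space $(\mathbf{g}(S),T[\mathbf{g}])$, where $T[\mathbf{g}]$ is the topology generated by the base $B=\{\mathbf{g}(\Omega)\mid \Omega \text{ is open}\}$, satisfies the property that any $p\in\mathbf{g}(S)$ has a neighbourhood $A\in T[\mathbf{g}]$ that is like $\mathbb{R}^k$.
   Context: $J_{\mathbf{g}}(\mathbf{x})=\left[\frac{\partial g_i}{\partial x_j}(\mathbf{x})\right]$ denotes the Jacobian matrix of $\mathbf{g}=(g_1,\dots,g_n)$ at $\mathbf{x}$. For a set $\Omega$, $\mathbf{g}(\Omega)=\{\mathbf{g}(x)\mid x\in\Omega\}$; in the definition of $B$, $\Omega$ ranges over the open subsets of the domain $S$ of $\mathbf{g}$. The topology $T[\mathbf{g}]$ on $\mathbf{g}(S)$ is called the topology induced by $\mathbf{g}$; it does not always coincide with the subspace topology on $\mathbf{g}(S)\subseteq\mathbb{R}^n$. A subset $U\subseteq\mathbb{R}^n$ is said to be like $\mathbb{R}^k$ if there exist an open set $V\subseteq\mathbb{R}^k$ and an infinitely differentiable one-to-one mapping $\phi:V\to U$ (a one-to-one correspondence between $V$ and $U$) whose inverse $\phi^{-1}:U\to V$ can be extended to an infinitely differentiable mapping $\psi:S'\to\mathbb{R}^k$ on an open superset $S'\supseteq U$, i.e. $\phi^{-1}(x)=\psi(x)$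 for $x\in U$. *)

(* Defs.v *)
From HB Require Import structures.
From mathcomp Require Import all_boot all_order all_algebra.
From mathcomp Require Import all_classical all_reals all_analysis.

Set Implicit Arguments.
Unset Strict Implicit.
Unset Printing Implicit Defensive.

Import Order.TTheory GRing.Theory Num.Theory.
Import numFieldNormedType.Exports.

Local Open Scope classical_set_scope.
Local Open Scope ring_scope.

Definition iter_partial (R : realType) (n m : nat) (s : seq 'I_n)
    (f : 'rV[R]_n -> 'rV[R]_m) : 'rV[R]_n -> 'rV[R]_m :=
  foldr (fun j h => 'D_(delta_mx 0 j) h) f s.

(* Only meant for an open [S]: the iterated partial derivatives at a point of
   [S] then depend only on the restriction of [f] to [S].  Differentiability of
   all of them on [S] is C^oo on [S]: it yields their existence and
   continuity, and conversely all partials of a C^oo map are C^1. *)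
Definition smooth_on (R : realType) (n m : nat) (S : set 'rV[R]_n)
    (f : 'rV[R]_n -> 'rV[R]_m) : Prop :=
  forall s : seq 'I_n, forall x, S x -> differentiable (iter_partial s f) x.

(* As [phi] is a bijection from [V] onto [U], the last clause says that
   [psi] agrees with the inverse of [phi] on [U]. *)
Definition like_Rk (R : realType) (n k : nat) (U : set 'rV[R]_n) : Prop :=
  exists (V : set 'rV[R]_k) (phi : 'rV[R]_k -> 'rV[R]_n),
    [/\ open V, smooth_on V phi, set_bij V U phi &
        exists (S' : set 'rV[R]_n) (psi : 'rV[R]_n -> 'rV[R]_k),
          [/\ open S', U `<=` S', smooth_on S' psi &
              forall v, V v -> psi (phi v) = v]].

(* A map with domain [S] is a total function [g], only looked at on [S].  The
   set [g @` S] is turned into a type of its own, so as to carry the topology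
   induced by [g] rather than the subspace topology. *)
Definition image_space (R : realType) (n m : nat) (S : set 'rV[R]_n)
    (g : 'rV[R]_n -> 'rV[R]_m) : Type := set_type (g @` S).

Definition image_space_val (R : realType) (n m : nat) (S : set 'rV[R]_n)
    (g : 'rV[R]_n -> 'rV[R]_m) (p : image_space S g) : 'rV[R]_m := \val p.

Definition open_sub (R : realType) (n : nat) (S : set 'rV[R]_n) :
  set (set 'rV[R]_n) := [set O | open O /\ O `<=` S].

Definition image_base (R : realType) (n m : nat) (S : set 'rV[R]_n)
    (g : 'rV[R]_n -> 'rV[R]_m) (O : set 'rV[R]_n) : set (image_space S g) :=
  [set p | (g @` O) (image_space_val p)].

Arguments image_base {R n m} S g O.

HB.instance Definition _ (R : realType) (n m : nat) (S : set 'rV[R]_n)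
    (g : 'rV[R]_n -> 'rV[R]_m) :=
  Choice.copy (image_space S g) (set_type (g @` S)).

(* The topology generated by the sets [g @` O], [O] open in [S].  These sets
   need not satisfy the intersection axiom of a base: for g(x, y) =
   (sin x, sin 2x), of constant rank 1, two of them meet in the single point 0.
   Hence the library's factory for subbases; when the axiom holds, the open
   sets are exactly the unions of sets [g @` O], see [union_of_base_open] and
   [open_union_of_base] below. *)
HB.instance Definition _ (R : realType) (n m : nat) (S : set 'rV[R]_n)
    (g : 'rV[R]_n -> 'rV[R]_m) :=
  isSubBaseTopological.Build (image_space S g) (open_sub S) (image_base S g).

(* Being open in the sense of "generated by a base", without intersections. *)
Definition union_of_base (R : realType) (n m : nat) (S : set 'rV[R]_n)
    (g : 'rV[R]_n -> 'rV[R]_m) (A : set (image_space S g)) : Prop :=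
  exists2 D, D `<=` open_sub S & A = \bigcup_(O in D) image_base S g O.

Lemma union_of_base_open (R : realType) (n m : nat) (S : set 'rV[R]_n)
    (g : 'rV[R]_n -> 'rV[R]_m) (A : set (image_space S g)) :
  union_of_base A -> open A.
Proof.
case=> D DS ->; apply: bigcup_open => O DO.
exists [set image_base S g O]; last by rewrite bigcup_set1.
by move=> _ ->; exact/finI_from1/DS.
Qed.

Lemma open_union_of_base (R : realType) (n m : nat) (S : set 'rV[R]_n)
    (g : 'rV[R]_n -> 'rV[R]_m) (A : set (image_space S g)) : open S ->
  (forall O1 O2 p, open_sub S O1 -> open_sub S O2 ->
     image_base S g O1 p -> image_base S g O2 p ->
     exists W, [/\ open_sub S W, image_base S g W p &
       image_base S g W `<=` image_base S g O1 `&` image_base S g O2]) ->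
  open A -> union_of_base A.
Proof.
move=> oS join [F FI <-].
exists [set W | open_sub S W /\ image_base S g W `<=` \bigcup_(X in F) X].
  by move=> W [].
apply/seteqP; split=> [p [X FX Xp] | p [W [_ OA] Op]]; last exact: OA.
have [/= E ES EX] := FI X FX; rewrite /= -EX in Xp.
suff H : forall s : seq (set 'rV[R]_n), (forall V, V \in s -> open_sub S V) ->
    (forall V, V \in s -> image_base S g V p) ->
    exists W, [/\ open_sub S W, image_base S g W p &
      forall V, V \in s -> image_base S g W `<=` image_base S g V].
  have [|//|W [SW Wp WE]] := H (finmap.enum_fset E); first by move=> V /ES /set_mem.
  exists W => //; split=> // q Wq; exists X => //=; rewrite -EX => V VE.
  exact: WE Wq.
elim=> [|V s IH] sS bp.
  exists S; split=> //; first by split.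
  by case: p Xp bp => y yS _ _; exact: set_mem yS.
have [V' Vs|V' Vs|W2 [SW2 W2p W2s]] := IH.
- by apply: sS; rewrite inE Vs orbT.
- by apply: bp; rewrite inE Vs orbT.
have SV := sS V (mem_head _ _); have Vp := bp V (mem_head _ _).
have [W [SW Wp WI]] := join _ _ _ SV SW2 Vp W2p.
exists W; split=> // V'; rewrite inE => /orP[/eqP -> q /WI[]//|/W2s V's q].
by move=> /WI[_ /V's].
Qed.

(* ['J] acts on row vectors from the right; its transpose is the matrix of the
   partial derivatives of the i-th component with respect to the j-th variable. *)
Lemma jacobian_trE (R : realType) (n m : nat) (g : 'rV[R]_n -> 'rV[R]_m)
    (x : 'rV[R]_n) (i : 'I_m) (j : 'I_n) : differentiable g x ->
  ('J g x)^T i j = 'D_(delta_mx 0 j) (fun y => g y 0 i) x.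
Proof.
move=> dg; rewrite mxE.
have /matrixP/(_ 0 i) := deriveEjacobian (delta_mx 0 j) dg.
rewrite -rowE mxE => <-.
by rewrite derive_mx ?mxE//; exact: diff_derivable.
Qed.

(* Main.v *)
From HB Require Import structures.
Require Import Defs.
From mathcomp Require Import all_boot all_order all_algebra.
From mathcomp Require Import all_classical all_reals all_analysis.
From mathcomp Require Import ring lra.

Set Implicit Arguments.
Unset Strict Implicit.
Unset Printing Implicit Defensive.

Import Order.TTheory GRing.Theory Num.Theory.
Import numFieldNormedType.Exports.

Local Open Scope classical_set_scope.
Local Open Scope ring_scope.

(** Fix [x0] in [S] and write the Jacobian of [g] at [x0] as [L E U], where [L]
    and [U] are invertible and [E] is the projection onto the first [k]
    coordinates.  The map [F x = g x U^-1 E + (x - x0) L (1 - E)] has the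
    invertible derivative [L] at [x0], so that it has a smooth local inverse
    [G].  As the rank of the Jacobian [J] of [g] is constantly [k], the kernel of
    [J U^-1 E] is not larger than that of [J], hence [g \o G] does not depend
    on the coordinates beyond [k], and [phi a = g (G (a, 0))] parametrizes the
    image of a neighbourhood of [x0].  Its inverse is the restriction of a linear
    map, namely the first [k] coordinates of [y U^-1]. *)

(** * Differentials, norm estimates and linear maps on row vectors *)

(** By uniqueness of the differential, an explicit error bound for a candidate [L] gives both
    differentiability and ['d f x = L]; later proofs then avoid little-o terms. *)
Lemma is_diff_norm_le (R : realType) (V W : normedModType R) (f : V -> W)
    (L : {linear V -> W}) (x : V) :
    continuous L ->
    (forall e, 0 < e -> \forall y \near x,
      `|f y - f x - L (y - x)| <= e * `|y - x|) ->
  is_diff x f L.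
Proof.
move=> cL H.
have E : f = cst (f x) + L \o center x +o_x (center x).
  apply/eqaddoP => e e0; have := H e e0; apply: filterS => y.
  by rewrite /= opprD addrA.
have D : f \o shift x = cst (f x) + L +o_ (0:V) id.
  apply/eqaddoP => e e0.
  rewrite [\forall x \near _, _ <= _](near_shift x); near=> y.
  have : `|f y - f x - L (y - x)| <= e * `|y - x| by near: y; exact: H.
  rewrite /= sub0r -[(f \o shift x - (cst (f x) + L)) (y - x)]/(f (y - x + x) -
    (f x + L (y - x))).
  by rewrite addrNK opprD addrA.
have U := diff_unique cL D.
by apply: DiffDef => //; apply/diff_locallyP; rewrite U; split.
Unshelve. all: by end_near. Qed.

Lemma differentiable_norm_le (R : realType) (V W : normedModType R) (f : V -> W)
    (x : V) : differentiable f x ->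
  forall e, 0 < e -> \forall y \near x,
      `|f y - f x - 'd f x (y - x)| <= e * `|y - x|.
Proof.
move=> /diff_locallyP[_ /eqaddoP H] e e0; have := H e e0.
rewrite [\forall x \near _, _ <= _](near_shift x) => K; near=> y.
have : (`|(f \o shift x - (cst (f x) + 'd f x)) (y - x)| <= e * `|y - x|).
  by near: y; move: K; apply: filterS => y; rewrite /= sub0r.
rewrite -[(f \o shift x - (cst (f x) + 'd f x)) (y - x)]/(f (y - x + x) -
    (f x + 'd f x (y - x))).
by rewrite addrNK opprD addrA.
Unshelve. all: by end_near. Qed.

Lemma near_eq_differentiable (R : realType) (V W : normedModType R)
    (f g : V -> W) (x : V) :
  (\forall y \near x, f y = g y) -> differentiable f x -> differentiable g x.
Proof.
move=> fg df.
suff [] : is_diff x g ('d f x) by [].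
apply: is_diff_norm_le; first exact: diff_continuous.
move=> e e0; near=> y; rewrite -(nbhs_singleton fg) -(near fg y)//.
by near: y; exact: differentiable_norm_le.
Unshelve. all: by end_near. Qed.

Lemma mx_coord_le (R : realType) n (v : 'rV[R]_n) i : `|v 0 i| <= `|v|.
Proof.
rewrite [leRHS]/Num.Def.normr/= mx_normrE.
exact: (le_bigmax _ (fun ij => `|v ij.1 ij.2|) (0, i)).
Qed.

Lemma mx_norm_le (R : realType) n (v : 'rV[R]_n) e :
  0 <= e -> (forall i, `|v 0 i| <= e) -> `|v| <= e.
Proof.
move=> e0 H; rewrite /Num.Def.normr/= mx_normrE (bigmax_le _ e0)//= => -[i j] _.
by rewrite (ord1 i).
Qed.

Lemma mulmx_norm_bound (R : realType) m n (A : 'M[R]_(m, n)) :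
  exists2 C, 0 < C & forall v : 'rV_m, `|v *m A| <= C * `|v|.
Proof.
(* The summand 1 keeps the constant positive even for [A = 0], so that it can be divided by. *)
exists (1 + \sum_i \sum_j `|A i j|).
  by rewrite ltr_wpDr// sumr_ge0// => i _; rewrite sumr_ge0.
move=> v; apply: mx_norm_le => [|j].
  by rewrite mulr_ge0// addr_ge0// sumr_ge0// => i _; rewrite sumr_ge0.
rewrite mxE (le_trans (ler_norm_sum _ _ _))// mulrDl mul1r ler_wpDl//.
rewrite mulr_suml ler_sum// => i _; rewrite mulrC normrM ler_pM//.
  by rewrite (bigD1 j)//= lerDl sumr_ge0.
exact: mx_coord_le.
Qed.

Lemma mulmxr_continuous (R : realType) m n (A : 'M[R]_(m, n)) :
  continuous (mulmxr A : 'rV_m -> 'rV_n).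
Proof.
have [C C0 H] := mulmx_norm_bound A.
move=> x; apply/(@cvgrPdist_le _ _ _ (nbhs (x : 'rV[R]_m))) => e e0; near=> y.
rewrite /= -mulmxBl (le_trans (H _))// -ler_pdivlMl//.
near: y; apply: cvgr_dist_le; last by rewrite mulr_gt0 ?invr_gt0.
exact: cvg_id.
Unshelve. all: by end_near. Qed.

Lemma is_diff_mulmxr (R : realType) m n (A : 'M[R]_(m, n)) x :
  is_diff x (fun v : 'rV_m => v *m A : 'rV_n) (mulmxr A).
Proof.
have c := @mulmxr_continuous R m n A.
by apply: DiffDef; [exact: (linear_differentiable (f := mulmxr A))
  | exact: (diff_lin (f := mulmxr A))].
Qed.

Lemma differentiable_rV (R : realType) (V : normedModType R) n
    (f : V -> 'rV[R]_n) x :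
  differentiable f x <-> forall i, differentiable (fun y => f y 0 i) x.
Proof.
split=> [df i|df].
  exact: (differentiable_comp df (differentiable_coord _ _ _)).
have -> : f = \sum_i (fun y => f y 0 i *: delta_mx 0 i).
  by apply/funext => y; rewrite fct_sumE; exact: row_sum_delta.
by apply: differentiable_sum => i; exact: differentiableZl.
Qed.

Lemma derive_partialE (R : realType) (V : normedModType R) n
    (f : 'rV[R]_n -> V) x v : differentiable f x ->
  'D_v f x = \sum_j v 0 j *: 'D_(delta_mx 0 j) f x.
Proof.
move=> df; rewrite deriveE// [in LHS](row_sum_delta v) linear_sum.
by apply: eq_bigr => j _; rewrite linearZ deriveE.
Qed.

(** * Smooth functions of several variables *)

Section smoothn.
Context {R : realType}.

(* The grading by [r], absent from [smooth_on], lets the chain rule and the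
   formula for the derivative of an inverse be used in inductions on [r]. *)
Fixpoint smoothn n (r : nat) (S : set 'rV[R]_n) (f : 'rV[R]_n -> R) : Prop :=
  (forall x, S x -> differentiable f x) /\
  (if r is r'.+1 then forall j, smoothn r' S ('D_(delta_mx 0 j) f) else True).

Lemma smoothn_diff n r (S : set 'rV[R]_n) f x :
  smoothn r S f -> S x -> differentiable f x.
Proof. by case: r => [|r] [df _]; exact: df. Qed.

Lemma smoothnW n r (S : set 'rV[R]_n) f : smoothn r.+1 S f -> smoothn r S f.
Proof.
elim: r f => [|r IH] f [df Df]; first by split.
by split=> // j; exact/IH/Df.
Qed.

Lemma smoothn_partial n r (S : set 'rV[R]_n) f j :
  smoothn r.+1 S f -> smoothn r S ('D_(delta_mx 0 j) f).
Proof. by case=> _ /(_ j). Qed.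

(** Openness turns agreement on [S] into agreement near each of its points, so partial derivatives
    agree on [S] as well. This allows a derivative to be replaced by a formula valid on [S] only. *)
Lemma eq_smoothn n r (S : set 'rV[R]_n) f g : open S ->
  {in S, f =1 g} -> smoothn r S f -> smoothn r S g.
Proof.
move=> oS; elim: r f g => [|r IH] f g fg [df Df].
all: have near_fg x : S x -> \forall y \near x, f y = g y
  by move=> Sx; apply: filterS (open_nbhs_nbhs (conj oS Sx)) => y /mem_set /fg.
all: split=> [x Sx|]; first exact: near_eq_differentiable (near_fg x Sx) (df x Sx).
  by [].
move=> j; apply: IH (Df j) => x /set_mem Sx.
exact: near_eq_derive (near_fg x Sx).
Qed.

Lemma smoothn_cst n r (S : set 'rV[R]_n) c : smoothn r S (fun=> c).
Proof.
elim: r c => [|r IH] c; first by split=> // x _; exact: differentiable_cst.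
split=> [x _|j]; first exact: differentiable_cst.
rewrite (_ : 'D__ _ = fun=> 0) //; apply/funext => x; exact: derive_cst.
Qed.

Lemma smoothn_coord n r (S : set 'rV[R]_n) i : smoothn r S (fun x => x 0 i).
Proof.
case: r => [|r]; first by split=> // x _; exact: differentiable_coord.
split=> [x _|j]; first exact: differentiable_coord.
rewrite (_ : 'D__ _ = fun=> (delta_mx 0 j : 'rV[R]_n) 0 i).
  exact: smoothn_cst.
apply/funext => x; have := derive_mx (@derivable_id _ _ x (delta_mx 0 j)).
by rewrite derive_id => /matrixP/(_ 0 i); rewrite [in RHS]mxE => ->.
Qed.

Lemma smoothnD n r (S : set 'rV[R]_n) f g : open S ->
  smoothn r S f -> smoothn r S g -> smoothn r S (fun x => f x + g x).
Proof.
move=> oS; elim: r f g => [|r IH] f g [df Df] [dg Dg].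
all: split=> [x Sx|]; first exact: (differentiableD (df x Sx) (dg x Sx)).
  by [].
move=> j; apply: (eq_smoothn oS) (IH _ _ (Df j) (Dg j)) => x /set_mem Sx.
rewrite -[RHS]/('D_(delta_mx 0 j) (f + g) x) deriveD//;
  apply: diff_derivable; [exact: df|exact: dg].
Qed.

Lemma smoothnM n r (S : set 'rV[R]_n) f g : open S ->
  smoothn r S f -> smoothn r S g -> smoothn r S (fun x => f x * g x).
Proof.
move=> oS; elim: r f g => [|r IH] f g sf sg.
  by case: sf sg => [df _] [dg _]; split=> // x Sx; exact: differentiableM (df x Sx) (dg x Sx).
have [sf' sg'] := (smoothnW sf, smoothnW sg).
case: sf sg => [df Df] [dg Dg]; split=> [x Sx|j].
  exact: differentiableM (df x Sx) (dg x Sx).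
apply: (eq_smoothn oS) (smoothnD oS (IH _ _ sf' (Dg j)) (IH _ _ sg' (Df j))).
move=> x /set_mem Sx.
by rewrite -[RHS]/('D_(delta_mx 0 j) (f * g) x) deriveM//;
  apply: diff_derivable; [exact: df|exact: dg].
Qed.

Lemma smoothnV n r (S : set 'rV[R]_n) f : open S -> (forall x, S x -> f x != 0) ->
  smoothn r S f -> smoothn r S (fun x => (f x)^-1).
Proof.
move=> oS f0; elim: r f f0 => [|r IH] f f0 sf.
  by case: sf => [df _]; split=> // x Sx; exact: differentiableV (df x Sx) (f0 x Sx).
(* The derivative of the inverse contains the inverse itself, which is available to order [r] by
   induction. *)
have sV := IH _ f0 (smoothnW sf); case: sf => [df Df]; split=> [x Sx|j].
  exact: differentiableV (df x Sx) (f0 x Sx).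
apply: (eq_smoothn oS) (smoothnM oS (smoothn_cst _ _ (-1))
  (smoothnM oS (smoothnM oS sV sV) (Df j))) => x /set_mem Sx.
rewrite deriveV ?f0//; last exact: diff_derivable (df x Sx).
by rewrite /GRing.scale /= expr2 invfM mulN1r mulNr.
Qed.

Lemma smoothn_sum n r (S : set 'rV[R]_n) I (s : seq I) (P : pred I) F : open S ->
  (forall i, smoothn r S (F i)) -> smoothn r S (fun x => \sum_(i <- s | P i) F i x).
Proof.
move=> oS sF; elim: s => [|i s IH].
  rewrite (_ : (fun _ => _) = fun=> 0); first exact: smoothn_cst.
  by apply/funext => x; rewrite big_nil.
case Pi : (P i).
  rewrite (_ : (fun _ => _) = fun x => F i x + \sum_(i <- s | P i) F i x).
    exact: smoothnD.
  by apply/funext => x; rewrite big_cons Pi.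
by under eq_fun do rewrite big_cons Pi.
Qed.

Lemma smoothn_prod n r (S : set 'rV[R]_n) I (s : seq I) (P : pred I) F : open S ->
  (forall i, smoothn r S (F i)) -> smoothn r S (fun x => \prod_(i <- s | P i) F i x).
Proof.
move=> oS sF; elim: s => [|i s IH].
  rewrite (_ : (fun _ => _) = fun=> 1); first exact: smoothn_cst.
  by apply/funext => x; rewrite big_nil.
case Pi : (P i).
  rewrite (_ : (fun _ => _) = fun x => F i x * \prod_(i <- s | P i) F i x).
    exact: smoothnM.
  by apply/funext => x; rewrite big_cons Pi.
by under eq_fun do rewrite big_cons Pi.
Qed.

Lemma smoothn_det n m r (S : set 'rV[R]_n) (A : 'rV[R]_n -> 'M[R]_m) : open S ->
  (forall i j, smoothn r S (fun x => A x i j)) -> smoothn r S (fun x => \det (A x)).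
Proof.
move=> oS sA; apply: smoothn_sum => // s.
by apply: smoothnM => //; [exact: smoothn_cst | exact: smoothn_prod].
Qed.

(** Cramer's rule: the entries are cofactors divided by the determinant, which does not vanish on
    [S]. *)
Lemma smoothn_invmx n m r (S : set 'rV[R]_n) (A : 'rV[R]_n -> 'M[R]_m) : open S ->
  (forall x, S x -> A x \in unitmx) ->
  (forall i j, smoothn r S (fun x => A x i j)) ->
  forall i j, smoothn r S (fun x => invmx (A x) i j).
Proof.
move=> oS uA sA i j.
have detA0 x : S x -> \det (A x) != 0 by move/uA; rewrite unitmxE unitfE.
have sdet := smoothn_det oS sA.
apply: (eq_smoothn oS) (smoothnM oS (smoothnV oS detA0 sdet) (_ : smoothn r S
  (fun x => cofactor (A x) j i))).
  by move=> x /set_mem Sx; rewrite /invmx uA// !mxE.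
apply: smoothnM => //; first exact: smoothn_cst.
apply: smoothn_det => // a b.
rewrite (_ : (fun _ => _) = fun x => A x (lift j a) (lift i b)) //.
by apply/funext => x; rewrite !mxE.
Qed.

Lemma derive_comp_partial n m (f : 'rV[R]_m -> R) (u : 'rV[R]_n -> 'rV[R]_m) x v :
  differentiable u x -> differentiable f (u x) ->
  'D_v (f \o u) x =
  \sum_i 'D_(delta_mx 0 i) f (u x) * 'D_v (fun y => u y 0 i) x.
Proof.
move=> du df; have dfu := differentiable_comp du df.
rewrite (deriveE _ dfu) (diff_comp du df) /=.
rewrite -(deriveE _ df) (derive_partialE _ df); apply: eq_bigr => i _.
rewrite -(deriveE _ du) derive_mx; last exact: diff_derivable.
by rewrite mxE mulrC.
Qed.

(** Induction through the chain rule: each partial derivative is a sum of products of a partial of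
    [f] composed with [u], covered by the induction hypothesis, and a partial of [u]. *)
Lemma smoothn_comp n m r (S : set 'rV[R]_n) (T : set 'rV[R]_m) f u : open S ->
  (forall x, S x -> T (u x)) -> smoothn r T f ->
  (forall i, smoothn r S (fun x => u x 0 i)) -> smoothn r S (f \o u).
Proof.
move=> oS uST; elim: r f => [|r IH] f sf su.
all: have du x : S x -> differentiable u x
  by move=> Sx; apply/differentiable_rV => i; exact: smoothn_diff (su i) Sx.
all: have df x : S x -> differentiable f (u x)
  by move=> Sx; exact: smoothn_diff sf (uST x Sx).
all: split=> [x Sx|]; first exact: differentiable_comp (du x Sx) (df x Sx).
  by [].
move=> j; apply: (eq_smoothn oS _ (smoothn_sum (index_enum 'I_m) xpredT oS (F := fun i x =>
    'D_(delta_mx 0 i) f (u x) * 'D_(delta_mx 0 j) (fun y => u y 0 i) x) _)).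
  by move=> x /set_mem Sx; rewrite derive_comp_partial; [|exact: du|exact: df].
move=> i; apply: smoothnM => //; last by case: (su i) => _ /(_ j).
by apply: (IH ('D_(delta_mx 0 i) f)) => [|k]; [by case: sf => _ /(_ i) | exact/smoothnW/su].
Qed.

Lemma iter_partial_rcons n m (s : seq 'I_n) j (f : 'rV[R]_n -> 'rV[R]_m) :
  iter_partial (rcons s j) f = iter_partial s ('D_(delta_mx 0 j) f).
Proof. by rewrite /iter_partial foldr_rcons. Qed.

Lemma smooth_on_partial n m (S : set 'rV[R]_n) (f : 'rV[R]_n -> 'rV[R]_m) j :
  smooth_on S f -> smooth_on S ('D_(delta_mx 0 j) f).
Proof. by move=> sf s x Sx; rewrite -iter_partial_rcons; exact: sf. Qed.

Lemma smooth_on_diff n m (S : set 'rV[R]_n) (f : 'rV[R]_n -> 'rV[R]_m) x :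
  smooth_on S f -> S x -> differentiable f x.
Proof. by move=> sf; exact: (sf [::] x). Qed.

Lemma smooth_onP n m (S : set 'rV[R]_n) (f : 'rV[R]_n -> 'rV[R]_m) : open S ->
  smooth_on S f <-> forall r i, smoothn r S (fun x => f x 0 i).
Proof.
move=> oS; split=> [sf r|sf s].
  elim: r f sf => [|r IH] f sf i.
    by split=> // x Sx; have /differentiable_rV := smooth_on_diff sf Sx.
  have df x (Sx : S x) : differentiable f x := smooth_on_diff sf Sx.
  split=> [x Sx|]; first by have /differentiable_rV := df x Sx.
  move=> j; apply: (eq_smoothn oS) (IH _ (smooth_on_partial j sf) i) => x.
  by move=> /set_mem Sx; rewrite derive_mx ?mxE//; exact/diff_derivable/df.
(* The last index of [s] is differentiated first, as in [smoothn], hence an induction from the right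
   end. *)
elim/last_ind: s f sf => [|s j IH] f sf x Sx.
  by apply/differentiable_rV => i; have [] := sf 0 i => /(_ x Sx).
rewrite iter_partial_rcons; apply: IH Sx => r i.
have [_ /(_ j)] := sf r.+1 i; apply: eq_smoothn => // y /set_mem Sy.
rewrite derive_mx ?mxE//; apply: diff_derivable; apply/differentiable_rV => k.
exact: smoothn_diff (sf 0 k) Sy.
Qed.

End smoothn.

Lemma smoothn_mulmx (R : realType) n m p r (S : set 'rV[R]_n)
    (u : 'rV[R]_n -> 'rV[R]_m) (A : 'M[R]_(m, p)) : open S ->
  (forall i, smoothn r S (fun x => u x 0 i)) ->
  forall i, smoothn r S (fun x => (u x *m A) 0 i).
Proof.
move=> oS su i; under eq_fun do rewrite mxE.
apply: (@smoothn_sum _ _ _ _ _ _ _ (fun j x => u x 0 j * A j i)) => // j.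
by apply: smoothnM => //; exact: smoothn_cst.
Qed.

(** * Jacobians, the mean value theorem and Lipschitz bounds on balls *)

Lemma jacobianE (R : realType) n m (f : 'rV[R]_n -> 'rV[R]_m) x i j :
  differentiable f x ->
  'J f x j i = 'D_(delta_mx 0 j) (fun y => f y 0 i) x.
Proof. by move=> df; rewrite -(jacobian_trE i j df) [RHS]mxE. Qed.

Lemma derive_coord (R : realType) n m (f : 'rV[R]_n -> 'rV[R]_m) x v i :
  differentiable f x -> 'D_v (fun y => f y 0 i) x = (v *m 'J f x) 0 i.
Proof.
move=> df; rewrite -deriveEjacobian// derive_mx ?mxE//; exact: diff_derivable.
Qed.

Lemma MVT_rV (R : realType) n (f : 'rV[R]_n -> R) x y :
  (forall t, t \in `[0, 1] -> differentiable f (x + t *: (y - x))) ->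
  exists2 t, t \in `[0, 1] & f y - f x = 'D_(y - x) f (x + t *: (y - x)).
Proof.
move=> df; pose h (t : R) := f (x + t *: (y - x)).
have dh (t : R) : t \in `[0, 1] -> is_derive t 1 h ('D_(y - x) f (x + t *: (y - x))).
  (* The difference quotient of [h] at [t] is that of [f] in the direction [y - x], so the
     one-variable theorem applies to [h]. *)
  move=> t01; have E : (fun s : R => s^-1 *: ((h \o shift t) (s *: (1 : R)) - h t)) =
    (fun s => s^-1 *: ((f \o shift (x + t *: (y - x))) (s *: (y - x)) -
                       f (x + t *: (y - x)))).
    apply/funext => s; rewrite /h /= [s%:A]mulr1; congr (_ *: (f _ - _)).
    by rewrite scalerDl addrCA.
  apply: DeriveDef; rewrite /derivable /derive E //.
  have D : derivable f (x + t *: (y - x)) (y - x) by apply/diff_derivable/df.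
  exact D.
have [t t01 E] := MVT_segment ler01
  (fun t t01 => dh t (subset_itv_oo_cc t01))
  (derivable_within_continuous (fun t t01 => ex_derive (is_derive := dh t t01))).
exists t => //; move: E; rewrite /h scale1r scale0r addr0 subr0 mulr1 => <-.
by rewrite [x + _]addrC subrK.
Qed.

Lemma ball_segment (R : realType) (V : normedModType R) (c : V) r x y t :
  ball c r x -> ball c r y -> t \in `[0, 1] -> ball c r (x + t *: (y - x)).
Proof.
rewrite -ball_normE /= in_itv /= => cx cy /andP[t0 t1].
have -> : c - (x + t *: (y - x)) = (1 - t) *: (c - x) + t *: (c - y).
  have -> : y - x = (c - x) - (c - y) by rewrite opprB [RHS]addrC subrKA.
  rewrite opprD addrA scalerBl scale1r [RHS]addrAC -[RHS]addrA.
  by rewrite [in LHS](scalerBr t) opprB.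
rewrite (le_lt_trans (ler_normD _ _))// !normrZ !ger0_norm ?subr_ge0//.
pose m := Num.max `|c - x| `|c - y|.
have mr : m < r by rewrite gt_max cx.
apply: le_lt_trans mr.
have xm : `|c - x| <= m by rewrite le_max lexx.
have ym : `|c - y| <= m by rewrite le_max lexx orbT.
by nra.
Qed.

(** The mean value theorem is applied to each component. In the sup norm the derivative along
    [y - x] is a sum of [n] terms of size at most [M] times the norm of [y - x], whence the factor
    [n]. *)
Lemma ball_lipschitz (R : realType) n m (f : 'rV[R]_n -> 'rV[R]_m) c r M :
  0 <= M ->
  (forall x, ball c r x -> differentiable f x) ->
  (forall x i j, ball c r x -> `|'J f x j i| <= M) ->
  forall x y, ball c r x -> ball c r y -> `|f y - f x| <= n%:R * M * `|y - x|.
Proof.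
move=> M0 df JM x y cx cy; apply: mx_norm_le => [|i]; first by rewrite !mulr_ge0.
have [|t t01] := @MVT_rV _ _ (fun z => f z 0 i) x y.
  by move=> t t01; have /differentiable_rV := df _ (ball_segment cx cy t01).
have cz := ball_segment cx cy t01.
rewrite !mxE derive_coord; last exact: df.
move=> ->; rewrite mxE (le_trans (ler_norm_sum _ _ _))//.
have -> : n%:R * M * `|y - x| = \sum_(j < n) `|y - x| * M.
  by rewrite sumr_const card_ord -mulr_natl; ring.
apply: ler_sum => j _; rewrite normrM ler_pM//; [exact: mx_coord_le|exact: JM].
Qed.

(** * Smoothness of a Lipschitz local inverse *)

Section inverse_smooth.
Context {R : realType} {n : nat}.
Variables (X B : set 'rV[R]_n) (F G : 'rV[R]_n -> 'rV[R]_n).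
Hypotheses (openX : open X) (openB : open B) (smoothF : smooth_on X F).
Hypothesis JF : forall x, X x -> 'J F x \in unitmx.
Hypothesis XG : forall u, B u -> X (G u).
Hypothesis FG : forall u, B u -> F (G u) = u.
Variable C : R.
Hypothesis C0 : 0 < C.
Hypothesis lipG : forall u v, B u -> B v -> `|G u - G v| <= C * `|u - v|.

Let contG u : B u -> G x @[x --> u] --> G u.
Proof.
move=> Bu; apply/(@cvgrPdist_le _ _ _ (nbhs u)) => e e0; near=> v.
have Bv : B v by near: v; exact: open_nbhs_nbhs.
rewrite (le_trans (lipG Bu Bv))// -ler_pdivlMl//.
near: v; apply: (@cvgr_dist_le _ _ _ (nbhs u) _ id); first exact: cvg_id.
by rewrite mulr_gt0 ?invr_gt0.
Unshelve. all: by end_near. Qed.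

(** The error of [G] at [u] is, up to sign, the error of [F] at [G u] multiplied by the inverse
    Jacobian; the Lipschitz bound turns smallness relative to [G v - G u] into smallness relative to
    [v - u]. *)
Lemma is_diff_inverse u : B u ->
  is_diff u G (mulmxr (invmx ('J F (G u)))).
Proof.
move=> Bu; have dF := smooth_on_diff smoothF (XG Bu).
set M := invmx _; have [D D0 MD] := mulmx_norm_bound M.
apply: is_diff_norm_le; first exact: mulmxr_continuous.
(* [D] will come from multiplication by [M] and [C] from the Lipschitz bound; dividing by both
   leaves [e]. *)
move=> e e0; pose e' := e / (D * C).
have e'0 : 0 < e' by rewrite divr_gt0 ?mulr_gt0.
have := contG Bu (differentiable_norm_le dF e'0); rewrite near_simpl => H.
near=> v.
have Bv : B v by near: v; exact: open_nbhs_nbhs.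
have : `|F (G v) - F (G u) - 'd F (G u) (G v - G u)| <= e' * `|G v - G u|.
  by near: v; exact: H.
rewrite !FG// -deriveE// deriveEjacobian// => Hv.
have -> : G v - G u - mulmxr M (v - u) =
    - (v - u - (G v - G u) *m 'J F (G u)) *m M.
  rewrite /= mulNmx [in RHS]mulmxBl mulmxK ?opprB//; exact/JF/XG.
rewrite mulNmx normrN (le_trans (MD _))//.
rewrite (le_trans (ler_wpM2l (ltW D0) Hv))// mulrA.
apply: le_trans (ler_wpM2l _ (lipG Bv Bu)) _; first by rewrite mulr_ge0// ltW.
by rewrite /e' mulrA ler_wpM2r// le_eqVlt; apply/orP; left; apply/eqP; field;
  rewrite !gt_eqF.
Unshelve. all: by end_near. Qed.

(** Bootstrapping: the Jacobian of [G] at [u] is the inverse of ['J F (G u)]. If [G] is smooth to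
    order [r], so is this inverse, and [G] gains one order. *)
Lemma inverse_smooth : smooth_on B G.
Proof.
apply/smooth_onP => //; elim=> [|r IH] i.
all: have dG u (Bu : B u) : differentiable G u by have [] := is_diff_inverse Bu.
all: split=> [u Bu|]; first by have /differentiable_rV := dG u Bu.
  by [].
have sF := (smooth_onP F openX).1 smoothF.
move=> j; apply: (eq_smoothn openB) (smoothn_invmx openB
    (A := fun u => 'J F (G u)) (fun u Bu => JF (XG Bu)) _ j i) => [u /set_mem Bu|a b].
  rewrite derive_coord; last exact: dG.
  rewrite -deriveEjacobian; last exact: dG.
  rewrite deriveE; last exact: dG.
  have [_ ->] := is_diff_inverse Bu.
  by rewrite /= -rowE mxE.
have := smoothn_comp openB XG _ IH.
move=> /(_ ('D_(delta_mx 0 a) (fun y => F y 0 b))) /(_ (smoothn_partial a (sF r.+1 b))).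
apply: eq_smoothn => // u /set_mem Bu /=.
by rewrite jacobianE//; exact: smooth_on_diff smoothF (XG Bu).
Qed.

End inverse_smooth.

(** * The inverse function theorem *)

Lemma is_diff_jacobian (R : realType) n m (f : 'rV[R]_n -> 'rV[R]_m) x :
  differentiable f x -> is_diff x f (mulmxr ('J f x)).
Proof.
move=> df; apply: DiffDef => //; apply/funext => v.
by rewrite -deriveE// deriveEjacobian.
Qed.

Lemma jacobian_val (R : realType) n m (f : 'rV[R]_n -> 'rV[R]_m) x M :
  is_diff x f (mulmxr M) -> 'J f x = M.
Proof.
move=> [_ dfM]; apply/row_matrixP => i.
by rewrite !rowE mul_rV_lin1 dfM.
Qed.

Lemma smoothn_jacobian (R : realType) n m r (S : set 'rV[R]_n)
    (f : 'rV[R]_n -> 'rV[R]_m) i j : open S -> smooth_on S f ->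
  smoothn r S (fun x => 'J f x j i).
Proof.
move=> oS sf; have := smoothn_partial j ((smooth_onP f oS).1 sf r.+1 i).
apply: eq_smoothn => // x /set_mem Sx.
by rewrite jacobianE//; exact: smooth_on_diff sf Sx.
Qed.

Lemma smoothn_near_dist (R : realType) n r (S : set 'rV[R]_n) f x e :
  smoothn r S f -> S x -> 0 < e -> \forall y \near x, `|f x - f y| < e.
Proof.
move=> sf Sx e0; have := differentiable_continuous (smoothn_diff sf Sx).
by move=> /cvgr_dist_lt /(_ e e0).
Qed.

Lemma smoothn_near_neq0 (R : realType) n r (S : set 'rV[R]_n) f x :
  smoothn r S f -> S x -> f x != 0 -> \forall y \near x, f y != 0.
Proof.
move=> sf Sx fx0; have := smoothn_near_dist sf Sx.
rewrite -normr_gt0 in fx0 => /(_ _ fx0); apply: filterS => y; apply: contraTneq => ->.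
by rewrite subr0 ltxx.
Qed.

(* Matrices are complete and normed, but the join was not declared. *)
HB.instance Definition _ (R : realType) m n := Complete.on 'M[R]_(m, n).

(** Banach's theorem is applied on the closed ball; since [f] sends it into the open ball, the fixed
    point lies there too. *)
Lemma ball_fixpoint (R : realType) (V : completeNormedModType R) (c : V) (r q : R)
    (f : V -> V) : 0 < r -> 0 <= q < 1 ->
  (forall x y, closed_ball c r x -> closed_ball c r y ->
     `|f x - f y| <= q * `|x - y|) ->
  (forall x, closed_ball c r x -> ball c r (f x)) ->
  exists2 x, ball c r x & f x = x.
Proof.
move=> r0 /andP[q0 q1] lipf fK.
have fK' : set_fun (closed_ball c r) (closed_ball c r) f.
  by move=> x Kx; exact/subset_closed_ball/fK.
have [|||x Kx xE] := @banach_fixed_point R V (closed_ball c r) (mkfun_fun fK').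
- by exists (NngNum q0); split=> // -[x y] [/= Kx Ky]; exact: lipf.
- exact: closed_ball_closed.
- by exists c; exact: closed_ballxx.
by exists x; [rewrite xE; exact: fK|rewrite {2}xE].
Qed.

Section inverse_function.
Context {R : realType} {n : nat}.
Variables (S : set 'rV[R]_n) (F : 'rV[R]_n -> 'rV[R]_n) (x0 : 'rV[R]_n).
Hypotheses (openS : open S) (Sx0 : S x0) (smoothF : smooth_on S F).
Hypothesis JF : 'J F x0 \in unitmx.

Let A := invmx ('J F x0).
Let H x := x - F x *m A.

Let smoothH : smooth_on S H.
Proof.
apply/smooth_onP => // r i.
have sF := (smooth_onP F openS).1 smoothF r.
apply: (eq_smoothn openS) (smoothnD openS (smoothn_coord _ _ i)
  (smoothnM openS (smoothn_cst _ _ (-1)) (smoothn_mulmx A openS sF i))).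
by move=> x _; rewrite mulN1r [in RHS]mxE [in RHS]mxE.
Qed.

(** [A] inverts the Jacobian of [F], so the linear parts of [x] and [F x *m A] cancel at [x0]. By
    continuity the Jacobian of [H] is small nearby, which makes [H] a contraction. *)
Let JH : 'J H x0 = 0.
Proof.
apply: jacobian_val.
have -> : mulmxr 0 = id - (mulmxr A \o mulmxr ('J F x0)) :> ('rV[R]_n -> 'rV[R]_n).
  apply/funext => v; rewrite -[RHS]/(v - v *m 'J F x0 *m A).
  by rewrite mulmxK// subrr /= mulmx0.
have dF := is_diff_jacobian (smooth_on_diff smoothF Sx0).
exact: (is_diffB (is_diff_id x0) (is_diff_comp dF (is_diff_mulmxr A (F x0)))).
Qed.

(* [F x = u] amounts to [x] being a fixed point of [fun x => H x + u *m A]. *)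
Lemma newton_contraction : exists2 e, 0 < e &
  [/\ ball x0 e `<=` S,
      forall x, ball x0 e x -> 'J F x \in unitmx &
      forall x y, ball x0 e x -> ball x0 e y ->
        `|H x - H y| <= 2^-1 * `|x - y|].
Proof.
(* Chosen so that the Lipschitz constant [n%:R * M] is at most 1/2; the successor keeps [M] positive
   for [n = 0]. *)
pose M : R := (2 * n.+1%:R)^-1.
have M0 : 0 < M by rewrite invr_gt0 mulr_gt0.
have : \forall x \near x0, [/\ S x, 'J F x \in unitmx &
    forall i j, `|'J H x j i| <= M].
  near=> x; split.
  - by near: x; exact: open_nbhs_nbhs.
  - rewrite unitmxE unitfE; near: x.
    apply: (@smoothn_near_neq0 _ _ 0 S (fun x => \det ('J F x))) => //.
      by apply: smoothn_det => // i j; exact: smoothn_jacobian.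
    by rewrite -unitfE -unitmxE.
  - move=> i j; have : `|'J H x0 j i - 'J H x j i| < M.
      move: i j; near: x; apply: filter_forall => i; apply: filter_forall => j.
      exact: (@smoothn_near_dist _ _ 0 S _ _ _ (smoothn_jacobian _ _ _ _ _)).
    by rewrite JH mxE sub0r normrN => /ltW.
move=> /nbhs_ballP[e /= e0 He]; exists e; first exact: e0.
split.
- by move=> x /He[].
- by move=> x /He[].
move=> x y ex ey.
have /le_trans -> // : `|H x - H y| <= n%:R * M * `|x - y|.
  apply: (ball_lipschitz (ltW M0) _ _ ey ex) => [z /He[Sz _ _]|z i j /He[]//].
  exact: smooth_on_diff smoothH Sz.
rewrite ler_wpM2r// /M invfM mulrA mulrAC -[leRHS]mul1r ler_wpM2r//.
by rewrite ler_pdivrMr// mul1r ler_nat.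
Unshelve. all: by end_near. Qed.

(** Fixed points of the shifted [H] solve [F x = u], the contraction bound makes them unique and
    Lipschitz in [u], and [inverse_smooth] applies. [F] may send points of the ball [X] outside the
    target ball, hence the extra premise of [G (F x) = x]. *)
Theorem inverse_function : exists (X : set 'rV[R]_n) r G,
  [/\ open X, X x0, X `<=` S, 0 < r &
   [/\ forall x, X x -> 'J F x \in unitmx,
       forall u, ball (F x0) r u -> X (G u),
       forall u, ball (F x0) r u -> F (G u) = u,
       forall x, X x -> ball (F x0) r (F x) -> G (F x) = x &
       smooth_on (ball (F x0) r) G]].
Proof.
have [e e0 [eS eJ eH]] := newton_contraction.
have [D D0 AD] := mulmx_norm_bound A.
(* Halving puts the closed ball of radius [p] inside the open ball where [H] contracts. *)
pose p := e / 2; have p0 : 0 < p by rewrite divr_gt0.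
have pe x : closed_ball x0 p x -> ball x0 e x.
  rewrite closed_ballE// -ball_normE /closed_ball_ /= => /le_lt_trans; apply.
  by rewrite /p; lra.
have bpe x : ball x0 p x -> ball x0 e x by move=> /subset_closed_ball /pe.
(* A shift of [u] by less than [r] moves the fixed-point map by less than [p / 2]; the contraction
   accounts for the other [p / 2]. *)
pose r := p / (2 * D); have r0 : 0 < r by rewrite divr_gt0 ?mulr_gt0.
have HE x u : H x + u *m A = x <-> F x = u.
  split=> [|<-]; last by rewrite subrK.
  move=> /eqP; rewrite /H -addrA -subr_eq0 addrAC subrr add0r addrC subr_eq0.
  move=> /eqP /(congr1 (mulmx^~ ('J F x0))).
  by rewrite /= !mulmxKV.
have fix_u u : ball (F x0) r u -> exists2 x, ball x0 p x & F x = u.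
  move=> ru; have [|x y px py|x px|x px xE] :=
    @ball_fixpoint _ _ x0 p 2^-1 (fun x => H x + u *m A) p0.
  - by rewrite invr_ge0 ler0n invf_lt1// ltr1n.
  - by rewrite opprD addrACA subrr addr0; apply: eH; exact: pe.
  - rewrite -ball_normE /=.
    have -> : x0 - (H x + u *m A) = (H x0 - H x) + (F x0 - u) *m A.
      have {1}-> : x0 = H x0 + F x0 *m A by apply/esym/HE.
      by rewrite mulmxBl opprD addrACA.
    have rA : `|(F x0 - u) *m A| < p / 2.
      rewrite (le_lt_trans (AD _))// -ltr_pdivlMl//.
      move: ru; rewrite -ball_normE /= => /lt_le_trans; apply.
      by rewrite /r invfM mulrA mulrC.
    have HxH : `|H x0 - H x| <= 2^-1 * `|x0 - x|.
      by apply: eH; [exact: ballxx|exact: pe].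
    have xp : `|x0 - x| <= p by move: px; rewrite closed_ballE.
    by rewrite (le_lt_trans (ler_normD _ _))//; lra.
  by exists x => //; exact/HE.
have lip u v x y : ball x0 p x -> ball x0 p y -> F x = u -> F y = v ->
    `|x - y| <= 2 * D * `|u - v|.
  move=> px py /HE xu /HE yv.
  (* Absorbing the first term into the left-hand side produces the factor 2. *)
  have : `|x - y| <= 2^-1 * `|x - y| + D * `|u - v|.
    have {1}-> : x - y = (H x - H y) + (u - v) *m A.
      by rewrite -{1}xu -{1}yv mulmxBl opprD addrACA.
    by rewrite (le_trans (ler_normD _ _))// lerD//; apply: eH; exact: bpe.
  by lra.
(* The default [x0] does not matter on the target ball, where [fix_u] provides a solution. *)
pose G u := xget x0 [set x | ball x0 p x /\ F x = u].
have GP u : ball (F x0) r u -> ball x0 p (G u) /\ F (G u) = u.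
  move=> /fix_u[x px Fx].
  by have := @xgetPex _ x0 [set x | ball x0 p x /\ F x = u]; apply; exists x.
exists (ball x0 p), r, G; split.
- exact: ball_open.
- exact: ballxx.
- by move=> x /bpe /eS.
- exact: r0.
split.
- by move=> x /bpe /eJ.
- by move=> u /GP[].
- by move=> u /GP[].
- move=> x px /GP[pG FG]; apply/eqP; rewrite -subr_eq0 -normr_le0.
  by rewrite (le_trans (lip _ _ _ _ pG px FG erefl))// subrr normr0 mulr0.
apply: (@inverse_smooth _ _ (ball x0 p) (ball (F x0) r) F G _ _ _ _ _ _ (2 * D)).
- exact: ball_open.
- exact: ball_open.
- by move=> s x /bpe /eS; exact: smoothF.
- by move=> x /bpe /eJ.
- by move=> u /GP[].
- by move=> u /GP[].
- by rewrite mulr_gt0.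
- move=> u v /GP[pu Fu] /GP[pv Fv]; exact: lip.
Qed.

End inverse_function.

(** * Maps of constant rank *)

(** Since [J *m P + Q] has rank [n], [J *m P] has rank at least [k]. Hence the kernel of [J],
    contained in that of [J *m P], has at least the same dimension, and the two agree. *)
Lemma kermx_mul_complement (K : fieldType) n k (J P Q : 'M[K]_n) (w : 'rV_n) :
  J *m P + Q \in unitmx -> \rank J = k -> (\rank Q <= n - k)%N ->
  w *m J *m P = 0 -> w *m J = 0.
Proof.
move=> uM rJ rQ wJP; have kn : (k <= n)%N by rewrite -rJ rank_leq_row.
have rJP : (k <= \rank (J *m P))%N.
  have := mxrank_add (J *m P) Q; rewrite mxrank_unit// => H.
  by rewrite -(leq_add2r (n - k)) subnKC// (leq_trans H)// leq_add2l.
have sK : (kermx J <= kermx (J *m P))%MS.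
  by apply/sub_kermxP; rewrite mulmxA mulmx_ker mul0mx.
have /geq_leqif := mxrank_leqif_sup sK.
rewrite !mxrank_ker rJ leq_sub2l// => /esym KJ.
have /submx_trans/(_ KJ)/sub_kermxP// : (w <= kermx (J *m P))%MS.
by apply/sub_kermxP; rewrite mulmxA.
Qed.

Lemma open_preimage_near (T U : topologicalType) (X : set T) (B : set U) (f : T -> U) :
  open X -> open B -> (forall x, X x -> {for x, continuous f}) ->
  open (X `&` f @^-1` B).
Proof.
move=> oX oB cf; rewrite openE => x [Xx Bfx]; apply: filterI.
  exact: open_nbhs_nbhs.
by apply: (cf x Xx); exact: open_nbhs_nbhs.
Qed.

Lemma derive_comp_jacobian (R : realType) (V : normedModType R) m p
    (f : 'rV[R]_m -> 'rV[R]_p) (u : V -> 'rV[R]_m) x v :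
  differentiable u x -> differentiable f (u x) ->
  'D_v (f \o u) x = 'D_v u x *m 'J f (u x).
Proof.
move=> du df; rewrite -deriveEjacobian// (deriveE _ df) (deriveE _ du).
by rewrite (deriveE _ (differentiable_comp du df)) (diff_comp du df).
Qed.

Section constant_rank.
Context {R : realType} {n k : nat}.
Variables (S : set 'rV[R]_n) (g : 'rV[R]_n -> 'rV[R]_n) (x0 : 'rV[R]_n).
Hypotheses (openS : open S) (smooth_g : smooth_on S g) (Sx0 : S x0).
Hypothesis rank_g : forall x, S x -> \rank ('J g x) = k.

Let L := col_ebase ('J g x0).
Let P := invmx (row_ebase ('J g x0)) *m pid_mx k : 'M[R]_n.
Let Q := L *m copid_mx k.
Let E := pid_mx k : 'M[R]_n.

(* By the choice of [P] and [Q], the derivative of [F] at [x0] is the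
   invertible matrix [L]; the first [k] coordinates of [F] are functions of
   [g], and the others vanish at [x0]. *)
Let F x := g x *m P + (x - x0) *m Q.

Let kn : (k <= n)%N. Proof. by rewrite -(rank_g Sx0) rank_leq_row. Qed.

Let EE : E *m E = E. Proof. exact: pid_mx_id. Qed.

Let PE : P *m E = P. Proof. by rewrite /P -mulmxA EE. Qed.

Let QE : Q *m E = 0.
Proof. by rewrite /Q -mulmxA mulmxBl mul1mx EE subrr mulmx0. Qed.

Let JF x : S x -> 'J F x = 'J g x *m P + Q.
Proof.
move=> Sx; apply: jacobian_val.
have dg := is_diff_jacobian (smooth_on_diff smooth_g Sx).
have d1 := is_diff_comp dg (is_diff_mulmxr P (g x)).
have d2 := is_diff_comp (is_diffB (is_diff_id x) (is_diff_cst x0 x))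
  (is_diff_mulmxr Q (x - x0)).
have -> : mulmxr ('J g x *m P + Q) = (mulmxr P \o mulmxr ('J g x)) +
    (mulmxr Q \o (id - 0)) :> ('rV[R]_n -> 'rV[R]_n).
  apply/funext => v; rewrite -[RHS]/(v *m 'J g x *m P + (v - 0) *m Q).
  by rewrite subr0 /= mulmxDr mulmxA.
exact: (is_diffD d1 d2).
Qed.

(** In the decomposition of ['J g x0], multiplication by [P] cancels the row factor and leaves
    [L *m E]; adding [Q] completes it to [L]. *)
Let JF0 : 'J F x0 \in unitmx.
Proof.
rewrite JF// -[X in X *m P]mulmx_ebase rank_g// /P !mulmxA.
rewrite mulmxK ?row_ebase_unit// -mulmxA EE -mulmxDr addrC subrK mulmx1.
exact: col_ebase_unit.
Qed.

Let smoothF : smooth_on S F.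
Proof.
apply/smooth_onP => // r i.
have sg := (smooth_onP g openS).1 smooth_g r.
have sx j : smoothn r S (fun x => (x - x0) 0 j).
  apply: (eq_smoothn openS) (smoothnD openS (smoothn_coord r S j)
    (smoothn_cst r S (- x0 0 j))) => x _.
  by rewrite !mxE.
apply: (eq_smoothn openS) (smoothnD openS (smoothn_mulmx P openS sg i)
  (smoothn_mulmx Q openS sx i)) => x _.
by rewrite [RHS]mxE.
Qed.

(** As [Q *m E = 0] and [P *m E = P], the premise says that [w *m 'J g x *m P] vanishes, and the
    kernel comparison applies. *)
Let ker_Jg x (w : 'rV[R]_n) : S x -> 'J F x \in unitmx -> w *m 'J F x *m E = 0 ->
  w *m 'J g x = 0.
Proof.
move=> Sx; rewrite JF// => uJ wE.
apply: (kermx_mul_complement uJ (rank_g Sx)).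
  by rewrite (leq_trans (mxrankM_maxr _ _))// rank_copid_mx.
move: wE; rewrite mulmxDr mulmxDl -(mulmxA w Q E) QE mulmx0 addr0.
by rewrite -(mulmxA w (_ *m P) E) -(mulmxA _ P E) PE mulmxA.
Qed.

(** If [v *m E = 0], then ['J F] sends ['D_v G z] to [v], so [ker_Jg] makes the derivative of
    [g \o G] along [v] vanish. The direction [u - u *m E] is such a [v], and the mean value theorem
    applies on the segment, which stays in the ball. *)
Lemma constant_rank_fibre (X : set 'rV[R]_n) r G :
  X `<=` S -> (forall x, X x -> 'J F x \in unitmx) ->
  (forall u, ball (F x0) r u -> X (G u)) ->
  (forall u, ball (F x0) r u -> F (G u) = u) ->
  smooth_on (ball (F x0) r) G ->
  forall u, ball (F x0) r u -> ball (F x0) r (u *m E) -> g (G u) = g (G (u *m E)).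
Proof.
move=> XS uJ XG FG smoothG u Bu BuE; apply/rowP => i.
have dG z (Bz : ball (F x0) r z) := smooth_on_diff smoothG Bz.
have SG z (Bz : ball (F x0) r z) := XS _ (XG z Bz).
have dgG z (Bz : ball (F x0) r z) : differentiable (g \o G) z.
  exact: differentiable_comp (dG z Bz) (smooth_on_diff smooth_g (SG z Bz)).
have D0 z v (Bz : ball (F x0) r z) (vE : v *m E = 0) : 'D_v (g \o G) z = 0.
  have dF := smooth_on_diff smoothF (SG z Bz).
  rewrite (derive_comp_jacobian v (dG z Bz) (smooth_on_diff smooth_g (SG z Bz))).
  apply: (ker_Jg (SG z Bz)); first exact/uJ/XG.
  rewrite -(derive_comp_jacobian v (dG z Bz) dF) -[RHS]vE; congr (_ *m _).
  (* [F \o G] is the identity near [z], so its derivative along [v] is [v]. *)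
  rewrite -[RHS](derive_id z v); apply: near_eq_derive.
  by apply: filterS FG _; exact: (open_nbhs_nbhs (conj (ball_open _ _) Bz)).
have [|t t01] := @MVT_rV _ _ (fun z => (g \o G) z 0 i) (u *m E) u.
  by move=> t t01; have /differentiable_rV := dgG _ (ball_segment BuE Bu t01).
have Bz := ball_segment BuE Bu t01.
rewrite (derive_coord _ _ (dgG _ Bz)) -(deriveEjacobian _ (dgG _ Bz)) D0//.
  by rewrite mxE => /eqP; rewrite subr_eq0 => /eqP.
by rewrite mulmxBl -mulmxA EE subrr.
Qed.

(** Multiplying [F (G u) = u] by [p] removes the [Q] part, so [P *m p] recovers the parameter [a]
    from [phi a]. Being linear, this inverse extends to the whole space. *)
Lemma constant_rank_image : exists O : set 'rV[R]_n,
  [/\ open O, O x0, O `<=` S & like_Rk k (g @` O)].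
Proof.
have [X [r [G [oX Xx0 XS r0 [uJ XG FG GF smoothG]]]]] :=
  inverse_function openS Sx0 smoothF JF0.
set B := ball (F x0) r in XG FG GF smoothG.
have oB : open B by exact: ball_open.
have fib u : B u -> B (u *m E) -> g (G u) = g (G (u *m E)) :=
  constant_rank_fibre XS uJ XG FG smoothG (u := u).
have BFx0 : B (F x0) by exact: ballxx.
clearbody B.
pose I := pid_mx k : 'M[R]_(k, n); pose p := pid_mx k : 'M[R]_(n, k).
have Ip : I *m p = 1%:M by rewrite pid_mx_id// pid_mx_1.
have pI : p *m I = E by rewrite pid_mx_id.
have Qp : Q *m p = 0.
  by rewrite /Q -mulmxA mulmxBl mul1mx pid_mx_id// subrr mulmx0.
(* This fixed point of the projection is what puts [x0] into [O] below. *)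
have Fx0E : F x0 *m E = F x0.
  by rewrite /F subrr mul0mx addr0 -mulmxA PE.
have contF x : X x -> {for x, continuous F}.
  by move=> Xx; exact/differentiable_continuous/(smooth_on_diff smoothF)/XS.
(* The fibre property [fib] compares [u] with [u *m E] and needs both in [B]. *)
pose B' := B `&` mulmxr E @^-1` B.
have oB' : open B'.
  exact: (open_preimage_near oB oB (fun u _ => @mulmxr_continuous R n n E u)).
pose O := X `&` F @^-1` B'.
exists O; split.
- exact: (open_preimage_near oX oB' contF).
- by split; [exact: Xx0 | split; rewrite /= ?Fx0E].
- by move=> x [/XS].
pose V := setT `&` mulmxr I @^-1` B.
have oV : open V.
  exact: (open_preimage_near openT oB (fun a _ => @mulmxr_continuous R k n I a)).
pose phi a := g (G (a *m I)).
have phi_p a : V a -> phi a *m (P *m p) = a.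
  move=> [_ Va]; have := FG _ Va.
  move=> /(congr1 (mulmx^~ p)); rewrite /F mulmxDl -2!mulmxA Qp mulmx0 addr0.
  by rewrite -[RHS]mulmxA Ip mulmx1.
exists V, phi; split.
- exact: oV.
- have sG := (smooth_onP G oB).1 smoothG.
  apply/smooth_onP => // s i.
  apply: (smoothn_comp (u := fun a => G (a *m I)) oV _
      ((smooth_onP g openS).1 smooth_g s i)) => [a [_ /XG/XS]//|j].
  apply: (smoothn_comp (u := fun a => a *m I) oV _ (sG s j)) => [a []//|l].
  by apply: (smoothn_mulmx I oV) => m; exact: smoothn_coord.
- split.
  (* [G (a *m I)] lies in [O], because its value [a *m I] under [F] is in [B] and is fixed by
     [E]. *)
  + move=> a [_ Va]; exists (G (a *m I)) => //; split; first exact: XG.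
    split; rewrite /= FG// -mulmxA (_ : I *m E = I)//.
    by rewrite -pI mulmxA Ip mul1mx.
  + by move=> a b /set_mem Va /set_mem Vb eab; rewrite -(phi_p a)// eab phi_p.
  (* The parameter of [g x] consists of the first [k] coordinates of [F x]; by [fib], dropping the
     remaining ones does not change the value of [g \o G]. *)
  + move=> _ [x [Xx [Bx BxE]] <-]; exists (F x *m p).
      by split=> //; rewrite /= -mulmxA pI.
    by rewrite /phi -mulmxA pI -fib// GF.
exists setT, (fun y => y *m (P *m p)); split=> //; first exact: openT.
apply/smooth_onP => [|s i]; first exact: openT.
by apply: smoothn_mulmx => [|j]; [exact: openT | exact: smoothn_coord].
Qed.

End constant_rank.

(** * Neighbourhoods in the induced topology *)

(** The neighbourhood is a single member of the base, the image of the set [O] around a preimage of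
    [p]; it is therefore open in both senses, whether or not the intersection axiom holds. *)
Theorem theorem2 (R : realType) (n k : nat) (S : set 'rV[R]_n)
    (g : 'rV[R]_n -> 'rV[R]_n)
    (openS : open S) (smooth_g : smooth_on S g)
    (rank_g : forall x : 'rV[R]_n, S x -> \rank ('J g x)^T = k) :
  forall p : image_space S g,
    exists A : set (image_space S g),
      [/\ open A, union_of_base A, A p &
          like_Rk k [set image_space_val q | q in A]].
Proof.
move=> p; have /set_mem[x Sx gx] := valP p.
have [|O [oO Ox OS likeO]] := constant_rank_image openS smooth_g Sx (k := k).
  by move=> y /rank_g; rewrite mxrank_tr.
have baseO : union_of_base (image_base S g O).
  exists [set O]; last by rewrite bigcup_set1.
  by move=> _ ->; split.
exists (image_base S g O); split=> //.
- exact: union_of_base_open.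
- by exists x.
(* Because [O] lies in [S], every point of the image of [O] lifts to the image space, so forgetting
   the subtype gives back that image. *)
rewrite (_ : [set _ | _ in _] = g @` O)//; apply/seteqP; split=> [_ [q Oq <-]//|].
move=> y Oy; have Sy : y \in g @` S by case: Oy => z /OS Sz <-; apply/mem_set; exists z.
by exists (SigSub Sy).
Qed.
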